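(* Let $\mathcal F$ be a hereditary saturated formation containing all nilpotent groups. Then the equality $$\mathrm{Int}^{*}_{\mathcal F}(G)=\mathrm{Int}_{\mathcal F}(G)$$ holds for every finite group $G$.
   Context: All groups are finite. A formation is a class $\mathcal F$ of groups closed under homomorphic images and such that, if $\mathcal F\ne\varnothing$, $G/G^{\mathcal F}\in\mathcal F$ for every group $G$, where $G^{\mathcal F}$ is the intersection of all normal subgroups $N$ of $G$ with $G/N\in\mathcal F$. It is saturated if $G\in\mathcal F$ whenever $G/\Phi(G)\in\mathcal F$, and hereditary if $H\le G\in\mathcal F$ implies $H\in\mathcal F$. A subgroup $U$ of $G$ is $\mathcal F$-maximal in $G$ if $U\in\mathcal F$ and $U\le V\le G$, $V\in\mathcal F$ imply $U=V$. $\mathrm{Int}_{\mathcal F}(G)$ is the intersection of all $\mathcal F$-maximal subgroups of $G$. A subgroup $H$ of $G$ is $K$-$\mathcal F$-subnormal in $G$ if either $H=G$ or there is a chain of subgroups $H=H_0<H_1<\dots<H_t=G$ such that for every $i=1,\dots,t$ either $H_{i-1}$ is normal in $H_i$ or $H_i/(H_{i-1})_{H_i}\in\mathcal F$, where $(H_{i-1})_{H_i}$ is the core of $H_{i-1}$ in $H_i$ (the largest normal subgroup of $H_i$ contained in $H_{i-1}$). $\mathrm{Int}^{*}_{\mathcal F}(G)$ is the intersection of all those $\mathcal F$-maximal subgroups of $G$ that are not $K$-$\mathcal F$-subnormal in $G$; if there are no such subgroups, $\mathrm{Int}^{*}_{\mathcal F}(G)=G$. *)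

(* Defs.v *)
From mathcomp Require Import all_boot all_fingroup all_solvable.
From mathcomp Require Import boolp.

Set Implicit Arguments.
Unset Strict Implicit.
Unset Printing Implicit Defensive.

Local Open Scope group_scope.

(* A finite group is a G : {group gT}, so a class of groups is a family of     *)
(* predicates indexed by the ambient type. Isomorphism invariance is not part  *)
(* of the type: for formations it follows from homomorph_closed, whose         *)
(* morphisms may change the ambient type.                                      *)
Definition group_class := forall gT : finGroupType, {group gT} -> Prop.

Section GroupClass.

Variable F : group_class.

(* The factor G :&: _ only matters when no N qualifies; this cannot happen for *)
(* a nonempty class closed under homomorphic images.                           *)
Definition residual (gT : finGroupType) (G : {group gT}) : {group gT} :=
  (G :&: \bigcap_(N : {group gT} | `[< N <| G /\ F (G / N)%G >]) N)%G.

Definition homomorph_closed : Prop :=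
  forall (aT rT : finGroupType) (G : {group aT}) (f : {morphism G >-> rT}),
    F G -> F (f @* G)%G.

Definition formation : Prop :=
  homomorph_closed /\
  ((exists (gT : finGroupType) (G : {group gT}), F G) ->
   forall (gT : finGroupType) (G : {group gT}), F (G / residual G)%G).

Definition saturated : Prop :=
  forall (gT : finGroupType) (G : {group gT}), F (G / 'Phi(G))%G -> F G.

Definition hereditary : Prop :=
  forall (gT : finGroupType) (G H : {group gT}), H \subset G -> F G -> F H.

Definition contains_nilpotent : Prop :=
  forall (gT : finGroupType) (G : {group gT}), nilpotent G -> F G.

Section Subgroups.

Variables (gT : finGroupType) (G : {group gT}).

Definition Fmaximal (U : {group gT}) : Prop :=
  [/\ U \subset G, F U &
      forall V : {group gT}, U \subset V -> V \subset G -> F V -> U = V].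

(* The case t = 0 is H = G. *)
Definition KFsubnormal (H : {group gT}) : Prop :=
  exists (t : nat) (c : nat -> {group gT}),
    [/\ c 0 = H, c t = G &
        forall i, i < t ->
          c i \proper c i.+1 /\
          (c i <| c i.+1 \/ F (c i.+1 / gcore (c i) (c i.+1))%G)].

(* An intersection over an empty family of subgroups of G is G: an empty       *)
(* \bigcap is the whole type gT, hence the factor G :&: _.                     *)
Definition Int : {group gT} :=
  (G :&: \bigcap_(U : {group gT} | `[< Fmaximal U >]) U)%G.

Definition Int_star : {group gT} :=
  (G :&: \bigcap_(U : {group gT} | `[< Fmaximal U /\ ~ KFsubnormal U >]) U)%G.

End Subgroups.

End GroupClass.

(* Main.v *)
Require Import Defs.
From mathcomp Require Import all_boot all_fingroup all_solvable.
From mathcomp Require Import boolp.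

(** One inclusion is clear, since the starred intersection runs over fewer
    subgroups. For the other one, a stronger statement is proved by induction
    on the order of G: a normal subgroup D of G that lies in every F-maximal
    subgroup which is not K-F-subnormal lies in all F-maximal subgroups
    ([star_bounded_sub]). It applies to [Int_star F G], which is normal because
    conjugation permutes the subgroups being intersected.

    The hypothesis on D passes to D :&: M in each subgroup M of G
    ([star_bounded_setI]) and to D / K in each quotient G / K
    ([star_bounded_quotient]), because K-F-subnormality is preserved by
    intersections and by images, and because F-maximal subgroups of M or G / K
    come from F-maximal subgroups of G. In the quotient this uses
    [F_supplement]: if G / K is in F, then G = K L with L in F.

    Suppose that D is not contained in some F-maximal U; then G is not in F.
    - If D U were proper in G, induction in D U would put D inside the
      F-maximal subgroup U of D U. So D U = G.
    - Induction in G / K, for K normal and nontrivial, shows that D / K lies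
      in an F-maximal subgroup containing U / K, so G / K is in F. Hence the
      F-residual R of G lies in every nontrivial normal subgroup of G, in
      particular in D, which is not 1.
    - Let W be any F-maximal subgroup with D not in W. Then W is
      K-F-subnormal and proper, so W lies in a proper subgroup M which is
      normal in G or has G / core(M) in F. Induction in M gives
      D :&: M <= V for an F-maximal V of M containing W, so that
      M = W (D :&: M) = V is in F and W = M. Thus W is itself normal, and
      nontrivial since F contains the cyclic groups, or G / core(W) is in F;
      in both cases R <= W.
    - So R lies in every F-maximal subgroup of G. By [F_supplement], G = R L
      with L in F, and an F-maximal subgroup containing L contains R L = G.
      Hence G is in F, a contradiction. *)

Set Implicit Arguments.
Unset Strict Implicit.
Unset Printing Implicit Defensive.

Local Open Scope group_scope.

(** * Classes closed under quotients and subgroups *)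

Section Theory.

Variable F : group_class.

(** K-F-subnormality in a form that is stable under intersections and images:
    repetitions are allowed, since strict inclusions may become equalities,
    and the core is replaced by any normal subgroup of K below H, since the
    image or trace of a core need not be a core. *)
Inductive Fchain (gT : finGroupType) (G : {group gT}) : {group gT} -> Prop :=
| Fchain_refl : Fchain G G
| Fchain_step (H K : {group gT}) :
    H \subset K ->
    H <| K \/
      (exists C : {group gT}, [/\ C <| K, C \subset H & F (K / C)%G]) ->
    Fchain G K -> Fchain G H.

Hypothesis hform : formation F.
Hypothesis hsat : saturated F.
Hypothesis hher : hereditary F.
Hypothesis hnil : contains_nilpotent F.

Lemma F_eq (gT : finGroupType) (G H : {group gT}) : G :=: H -> F G -> F H.
Proof. by move=> /val_inj ->. Qed.

(** The morphism g factors through K / C. When C is not inside K, the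
    quotient K / C is K C / C, so the second isomorphism theorem is built in. *)
Lemma F_factor (aT rT : finGroupType) (K C : {group aT})
    (g : {morphism K >-> rT}) :
  K \subset 'N(C) -> C :&: K \subset 'ker g -> F (K / C)%G -> F (g @* K)%G.
Proof.
move=> nCK sker FKC.
pose q := [morphism of restrm nCK (coset C)].
have kq : 'ker q \subset 'ker g.
  by rewrite ker_restrm ker_coset setIC.
have qK : q @* K = K / C by rewrite /= im_restrm.
apply: (@F_eq _ (factm kq (subxx K) @* (q @* K))%G).
  exact: morphim_factm.
by apply: hform.1; apply: F_eq FKC.
Qed.

Lemma F_morphim (aT rT : finGroupType) (D K : {group aT})
    (f : {morphism D >-> rT}) :
  K \subset D -> F K -> F (f @* K)%G.
Proof.
move=> sKD FK; have := hform.1 _ _ _ [morphism of restrm sKD f] FK.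
by apply: F_eq; rewrite /= im_restrm.
Qed.

Lemma F_quotient (gT : finGroupType) (K C : {group gT}) :
  K \subset 'N(C) -> F K -> F (K / C)%G.
Proof. exact: F_morphim. Qed.

Lemma F_quotient_trans (gT : finGroupType) (K C E : {group gT}) :
    K \subset 'N(C) -> K \subset 'N(E) -> C :&: K \subset E ->
  F (K / C)%G -> F (K / E)%G.
Proof.
move=> nCK nEK sCE FKC.
pose g := [morphism of restrm nEK (coset E)].
have kg : C :&: K \subset 'ker g.
  by rewrite ker_restrm ker_coset subsetI subsetIr.
by have := F_factor nCK kg FKC; apply: F_eq; rewrite /= im_restrm.
Qed.

Lemma residual_normal (gT : finGroupType) (G : {group gT}) :
  residual F G <| G.
Proof.
rewrite /normal subsetIl normsI ?normG //; apply/norms_bigcap/bigcapsP.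
by move=> N /asboolP[/andP[_ ->]].
Qed.

Lemma F_residual (gT : finGroupType) (G : {group gT}) :
  F (G / residual F G)%G.
Proof. by apply: hform.2; exists gT, 1%G; apply/hnil/nilpotent1. Qed.

Lemma residual_min (gT : finGroupType) (G N : {group gT}) :
  N <| G -> F (G / N)%G -> residual F G \subset N.
Proof.
by move=> nNG FGN; rewrite /= subIset // bigcap_inf ?orbT //; apply/asboolP.
Qed.

(** Take L minimal with K L = G. A maximal subgroup M of L not containing
    K :&: L would satisfy (K :&: L) M = L, hence K M = G; so K :&: L lies in the
    Frattini subgroup of L. Then L modulo its Frattini subgroup is an image of
    L / (K :&: L), which is isomorphic to G / K, and saturation gives L in F. *)
Lemma F_supplement (gT : finGroupType) (G K : {group gT}) :
    K <| G -> F (G / K)%G ->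
  exists L : {group gT}, [/\ L \subset G, K * L = G & F L].
Proof.
move=> /andP[sKG nKG] FGK.
have KG : (G \subset G) && (K * G == G) by rewrite subxx mulSGid //=.
have [L /mingroupP[/andP[sLG /eqP KL] minL] _] := @mingroup_exists
  _ [pred L : {group gT} | (L \subset G) && (K * L == G)] G KG.
exists L; split=> //; apply: hsat.
have nKL := subset_trans sLG nKG.
apply: (F_quotient_trans nKL).
- exact: normal_norm (Phi_normal L).
- apply/bigcapsP=> M /predU1P[-> | maxM]; first exact: subsetIr.
  have sML := maxgroupp maxM; have := maxM => /maxgroupP[_ maxM'].
  apply: contraT => nsKLM.
  have nKLL : L \subset 'N(K :&: L) by rewrite normsI ?normG.
  have nKLM := subset_trans (proper_sub sML) nKLL.
  have defL : (K :&: L) * M = L.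
    apply/eqP; rewrite eqEproper mul_subG ?subsetIr ?proper_sub //=.
    apply: contra nsKLM; rewrite -norm_joinEr // => ltL.
    by rewrite -(maxM' _ ltL (joing_subr _ _)) joing_subl.
  have eqML : M :=: L.
    apply: minL; last exact: proper_sub.
    rewrite /= (subset_trans (proper_sub sML) sLG) /=.
    by rewrite -KL -defL mulgA (mulGSid (subsetIl K L)).
  by rewrite eqML properxx in sML.
- by apply: F_eq FGK; rewrite /= -KL quotientMidl.
Qed.

(** * F-maximal subgroups *)

Lemma Fmaximal_exists (gT : finGroupType) (G L : {group gT}) :
  L \subset G -> F L -> exists2 U, Fmaximal F G U & L \subset U.
Proof.
move=> sLG FL.
have PL : (L \subset G) && `[< F L >] by rewrite sLG; apply/asboolP.
have [U /maxgroupP[/andP[sUG /asboolP FU] maxU] sLU] := @maxgroup_exists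
  _ [pred U : {group gT} | (U \subset G) && `[< F U >]] L PL.
exists U => //; split=> // V sUV sVG FV; apply/esym/val_inj/maxU => //.
by rewrite /= sVG; apply/asboolP.
Qed.

Lemma Fmaximal_in_F (gT : finGroupType) (G U : {group gT}) :
  F G -> Fmaximal F G U -> U = G.
Proof. by move=> FG [sUG _ maxU]; apply: maxU. Qed.

(** If G is nontrivial, a nontrivial cyclic subgroup is an F-subgroup properly
    containing 1. *)
Lemma Fmaximal_trivial (gT : finGroupType) (G : {group gT}) :
  Fmaximal F G 1%G -> G :=: 1.
Proof.
move=> [_ _ max1]; apply/trivgP/subsetP=> x Gx.
have Fx : F <[x]>%G by apply/hnil/abelian_nil/cycle_abelian.
have sxG : <[x]>%G \subset G by rewrite /= cycle_subG.
by rewrite (congr1 val (max1 _ (sub1G _) sxG Fx) : 1 = <[x]>) cycle_id.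
Qed.

(** * K-F-subnormal subgroups *)

Lemma Fchain_sub (gT : finGroupType) (G H : {group gT}) :
  Fchain G H -> H \subset G.
Proof. by elim=> // {}H K sHK _ _; apply: subset_trans. Qed.

Lemma KFsubnormal_chain (gT : finGroupType) (G H : {group gT}) :
  KFsubnormal F G H -> Fchain G H.
Proof.
move=> [t [c [<- <- hc]]].
elim: t c hc => [|t IHt] c hc; first exact: Fchain_refl.
have [ltc hstep] := hc 0 isT.
apply: (@Fchain_step _ _ _ (c 1%N)); first exact: proper_sub.
  case: hstep => [nc | Fc]; [by left | right].
  exists (gcore (c 0) (c 1%N))%G.
  by split; rewrite ?gcore_sub ?gcore_normal ?proper_sub.
by apply: (IHt (fun i => c i.+1)) => i lti; apply: hc.
Qed.

Lemma chain_KFsubnormal (gT : finGroupType) (G H : {group gT}) :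
  Fchain G H -> KFsubnormal F G H.
Proof.
elim=> [|{}H K sHK hHK _ [t [c [c0 ct hc]]]].
  by exists 0, (fun=> G); split.
have [eqHK | neHK] := eqVneq (H : {set gT}) K.
  by rewrite (val_inj eqHK); exists t, c.
exists t.+1, (fun i => if i is j.+1 then c j else H); split=> //.
case=> [|i] lti; last exact: hc.
rewrite c0 properEneq neHK sHK; split=> //.
case: hHK => [nHK | [C [/andP[sCK nCK] sCH FKC]]]; [by left | right].
apply: F_quotient_trans FKC => //; first exact: gcore_norm.
by rewrite subIset // gcore_max.
Qed.

Lemma KFsubnormal_morphim (aT rT : finGroupType) (D G H : {group aT})
    (f : {morphism D >-> rT}) :
  G \subset D -> KFsubnormal F G H -> KFsubnormal F (f @* G)%G (f @* H)%G.
Proof.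
move=> sGD /KFsubnormal_chain chH; apply: chain_KFsubnormal.
elim: chH => [|{}H K sHK hHK chK IH]; first exact: Fchain_refl.
apply: (@Fchain_step _ _ _ (f @* K)%G) => //; first exact: morphimS.
have sKD := subset_trans (Fchain_sub chK) sGD.
case: hHK => [nHK | [C [nCK sCH FKC]]].
  by left; apply: morphim_normal.
right; exists (f @* C)%G; split; [exact: morphim_normal | exact: morphimS |].
have nfCK : f @* K \subset 'N(f @* C) := morphim_norms f (normal_norm nCK).
have sKp : K \subset f @*^-1 'N(f @* C) by rewrite -sub_morphim_pre.
pose g := [morphism of restrm sKp (coset (f @* C) \o f)].
have kg : C :&: K \subset 'ker g.
  rewrite ker_restrm ker_comp ker_coset subsetI subsetIr /=.
  rewrite subIset // -sub_morphim_pre ?subxx //.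
  exact: subset_trans (normal_sub nCK) sKD.
have := F_factor (normal_norm nCK) kg FKC; apply: F_eq.
by rewrite /= im_restrm morphim_comp.
Qed.

Lemma KFsubnormal_setI (gT : finGroupType) (G H M : {group gT}) :
  M \subset G -> KFsubnormal F G H -> KFsubnormal F M (H :&: M)%G.
Proof.
move=> sMG /KFsubnormal_chain chH; apply: chain_KFsubnormal.
elim: chH => [|{}H K sHK hHK _ IH].
  have -> : (G :&: M)%G = M by apply/val_inj/setIidPr.
  exact: Fchain_refl.
apply: (@Fchain_step _ _ _ (K :&: M)%G) => //; first exact: setSI.
have nsI (A : {group gT}) : A <| K -> (A :&: M)%G <| (K :&: M)%G.
  move=> /andP[sAK nAK]; rewrite /normal setSI //= normsI //.
    exact: subset_trans (subsetIl K M) nAK.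
  by rewrite subIset // normG orbT.
case: hHK => [nHK | [C [nCK sCH FKC]]]; first by left; apply: nsI.
right; exists (C :&: M)%G; split; [exact: nsI | exact: setSI |].
have sKMK := subsetIl K M.
apply: F_quotient_trans (hher (quotientS C sKMK) FKC).
- exact: subset_trans sKMK (normal_norm nCK).
- exact: normal_norm (nsI C nCK).
- by rewrite /= setIA setSI ?subsetIl.
Qed.

(** M is the last proper term of the chain. *)
Lemma KFsubnormal_top (gT : finGroupType) (G H : {group gT}) :
    KFsubnormal F G H -> H != G ->
  exists M : {group gT}, [/\ H \subset M, M \proper G &
    M <| G \/ F (G / gcore M G)%G].
Proof.
move=> [[|t] [c [<- <- hc]]]; rewrite ?eqxx // => _.
have [ltc hstep] := hc t (ltnSn t).
exists (c t); split=> //.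
have sub0 i : i <= t.+1 -> c 0 \subset c i.
  elim: i => // i IHi lti.
  exact: subset_trans (IHi (ltnW lti)) (proper_sub (hc i lti).1).
exact: sub0.
Qed.

(** * The intersection of the F-maximal subgroups that are not K-F-subnormal *)

Lemma FmaximalJ (gT : finGroupType) (G U : {group gT}) x :
  x \in G -> Fmaximal F G U -> Fmaximal F G (U :^ x)%G.
Proof.
have FJ (V : {group gT}) y : F V -> F (V :^ y)%G.
  move=> /(F_morphim [morphism of conjgm V y] (subxx V)).
  by apply: F_eq; rewrite /= morphim_conj setIid.
move=> Gx [sUG FU maxU]; split; [by rewrite /= -(conjGid Gx) conjSg | exact: FJ |].
move=> V sUV sVG FV; have {}maxU := maxU (V :^ x^-1)%G.
apply/val_inj; rewrite /= maxU /= ?conjsgKV //; last exact: FJ.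
- by rewrite -sub_conjg.
- by rewrite sub_conjgV conjGid.
Qed.

Lemma KFsubnormalJ (gT : finGroupType) (G U : {group gT}) x :
  x \in G -> U \subset G -> KFsubnormal F G U -> KFsubnormal F G (U :^ x)%G.
Proof.
move=> Gx sUG /(KFsubnormal_morphim [morphism of conjgm G x] (subxx G)).
have -> : (conjgm G x @* G)%G = G.
  by apply/val_inj; rewrite /= morphim_conj setIid conjGid.
have -> // : (conjgm G x @* U)%G = (U :^ x)%G.
by apply/val_inj; rewrite /= morphim_conj (setIidPr sUG).
Qed.

Lemma Int_star_sub (gT : finGroupType) (G U : {group gT}) :
  Fmaximal F G U -> ~ KFsubnormal F G U -> Int_star F G \subset U.
Proof.
by move=> maxU nsU; rewrite /= subIset // bigcap_inf ?orbT //; apply/asboolP.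
Qed.

Lemma Int_star_normal (gT : finGroupType) (G : {group gT}) :
  Int_star F G <| G.
Proof.
rewrite /normal subsetIl; apply/subsetP=> x Gx; rewrite inE.
rewrite /= conjIg conjGid // subsetI subsetIl -{1}(conjGid Gx) -conjIg.
apply/bigcapsP=> U /asboolP[maxU nsU].
have Gx' : x^-1 \in G by rewrite groupV.
rewrite -[U : {set gT}](conjsgKV x) conjSg.
apply: Int_star_sub (FmaximalJ Gx' maxU) _ => snU; apply: nsU.
have [sUxG _ _] := FmaximalJ Gx' maxU.
have := KFsubnormalJ Gx sUxG snU.
by have -> : ((U :^ x^-1) :^ x)%G = U by apply/val_inj/conjsgKV.
Qed.

(** * The induction *)

(** This replaces the subgroup [Int_star F G] in the induction: its trace on a
    subgroup, or its image in a quotient, is only contained in the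
    corresponding intersection there. *)
Definition star_bounded (gT : finGroupType) (D G : {group gT}) : Prop :=
  D <| G /\
  forall U : {group gT}, Fmaximal F G U -> ~ KFsubnormal F G U -> D \subset U.

(** An F-maximal V of M is U :&: M for some F-maximal U of G, and if U is
    K-F-subnormal in G, then so is V in M. *)
Lemma star_bounded_setI (gT : finGroupType) (D G M : {group gT}) :
  M \subset G -> star_bounded D G -> star_bounded (D :&: M)%G M.
Proof.
move=> sMG [nDG starD]; split; first by rewrite /= setIC (normalGI sMG).
move=> V [sVM FV maxV] nsV.
have [U maxU sVU] := Fmaximal_exists (subset_trans sVM sMG) FV.
have [sUG FU _] := maxU.
have defV : V = (U :&: M)%G.
  apply: maxV; rewrite /= ?subsetI ?sVU ?subsetIr //.
  exact: hher (subsetIl U M) FU.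
rewrite defV; apply/setSI/(starD _ maxU) => snU; apply: nsV.
by rewrite defV; apply: KFsubnormal_setI sMG snU.
Qed.

(** An F-maximal subgroup V / K of G / K is U / K for some F-maximal U of G:
    write V = K L with L in F and take U above L. *)
Lemma star_bounded_quotient (gT : finGroupType) (D G K : {group gT}) :
  K <| G -> star_bounded D G -> star_bounded (D / K)%G (G / K)%G.
Proof.
move=> nKG [nDG starD]; split; first exact: quotient_normal.
move=> V' maxV' nsV'; have [sV'G FV' _] := maxV'.
have [V defV sKV sVG] := inv_quotientS nKG sV'G.
have nKV := normalS sKV sVG nKG.
have FVK : F (V / K)%G by apply: F_eq FV'.
have [L [sLV defKL FL]] := F_supplement nKV FVK.
have [U maxU sLU] := Fmaximal_exists (subset_trans sLV sVG) FL.
have [sUG FU _] := maxU.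
have nKU := subset_trans sUG (normal_norm nKG).
have defV' : V' = (U / K)%G.
  have [_ _ maxV'U] := maxV'; apply: maxV'U.
  - by rewrite defV -defKL quotientMidl quotientS.
  - exact: quotientS.
  - exact: F_quotient.
rewrite defV'; apply/quotientS/(starD _ maxU) => snU; apply: nsV'.
rewrite defV'.
exact: KFsubnormal_morphim (normal_norm nKG) snU.
Qed.

Theorem star_bounded_sub (gT : finGroupType) (D G U : {group gT}) :
  star_bounded D G -> Fmaximal F G U -> D \subset U.
Proof.
have [n] := ubnP #|G|.
elim: n gT D G U => // n IHn gT D G U0 leGn starD maxU0.
have [nDG starD'] := starD; have /andP[sDG nDG'] := nDG.
have [FG | nFG] := pselect (F G); first by rewrite (Fmaximal_in_F FG maxU0).
(* By induction in M, the subgroup M = U (D :&: M) is in F. *)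
have proper_overgroup_eq (U M : {group gT}) :
    Fmaximal F G U -> U \subset M -> M \proper G -> D * U = G -> U = M.
  move=> [sUG FU maxU] sUM ltMG defG; apply: maxU => //.
    exact: proper_sub.
  have [V maxV sUV] := Fmaximal_exists sUM FU.
  have sDMV : D :&: M \subset V.
    apply: IHn (star_bounded_setI (proper_sub ltMG) starD) maxV.
    exact: leq_trans (proper_card ltMG) leGn.
  have [sVM FV _] := maxV; apply: F_eq FV; apply/eqP.
  rewrite eqEsubset sVM -{1}(setIidPr (proper_sub ltMG)) -defG.
  by rewrite setIC -group_modr // setIC mul_subG.
(* By induction in D U, if D U were proper then D would lie in U. *)
have defG (U : {group gT}) :
    Fmaximal F G U -> ~~ (D \subset U) -> D * U = G.
  move=> maxU nsDU; have [sUG FU maxU'] := maxU.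
  have nDU := subset_trans sUG nDG'.
  rewrite -norm_joinEr //; apply/eqP; rewrite eqEproper join_subG sDG sUG /=.
  apply: contra nsDU => ltDUG.
  have [V maxV sUV] := Fmaximal_exists (joing_subr D U) FU.
  have [sVDU FV _] := maxV.
  have sDV : D \subset V.
    have -> : (D : {set gT}) = (D :&: (D <*> U)%G)%G.
      by apply/esym/setIidPl/joing_subl.
    apply: IHn (star_bounded_setI (proper_sub ltDUG) starD) maxV.
    exact: leq_trans (proper_card ltDUG) leGn.
  rewrite (maxU' V) //.
  exact: subset_trans sVDU (proper_sub ltDUG).
apply: contraT => nsDU0; have defG0 := defG _ maxU0 nsDU0.
have [sU0G FU0 _] := maxU0.
(* By induction in G / K, the quotient G / K is in F. *)
have residual_sub (K : {group gT}) :
    K <| G -> K :!=: 1 -> residual F G \subset K.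
  move=> nKG ntK; apply: residual_min => //.
  have nKU0 := subset_trans sU0G (normal_norm nKG).
  have [V maxV sU0V] := Fmaximal_exists (quotientS K sU0G) (F_quotient nKU0 FU0).
  have sDV : D / K \subset V.
    apply: IHn (star_bounded_quotient nKG starD) maxV.
    exact: leq_trans (ltn_quotient ntK (normal_sub nKG)) leGn.
  have [sVG FV _] := maxV; apply: F_eq FV; apply/eqP.
  rewrite eqEsubset sVG /= -defG0 quotientMl ?mul_subG //.
  exact: subset_trans sDG (normal_norm nKG).
have ntD : D :!=: 1 by apply: contraNneq nsDU0 => ->; apply: sub1G.
have sRU (U : {group gT}) : Fmaximal F G U -> residual F G \subset U.
  move=> maxU; have [sUG FU _] := maxU.
  have [sDU | nsDU] := boolP (D \subset U).
    exact: subset_trans (residual_sub D nDG ntD) sDU.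
  have snU : KFsubnormal F G U.
    by apply: contrapT => nsU; rewrite starD' in nsDU.
  have neUG : U != G by apply/eqP=> eqUG; apply: nFG; rewrite -eqUG.
  have [M [sUM ltMG hM]] := KFsubnormal_top snU neUG.
  have eqUM := proper_overgroup_eq U M maxU sUM ltMG (defG U maxU nsDU).
  rewrite -eqUM in hM; case: hM => [nUG | FGU]; last first.
    apply: subset_trans (residual_min _ FGU) (gcore_sub U G).
    exact: gcore_normal.
  apply: residual_sub => //; apply/eqP=> U1.
  have eqU1 : U = 1%G by apply: val_inj.
  apply: nFG; apply: F_eq FU.
  by rewrite U1 (Fmaximal_trivial (G := G)) // -eqU1.
have [L [sLG defRL FL]] := F_supplement (residual_normal G) (F_residual G).
have [U maxU sLU] := Fmaximal_exists sLG FL.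
have [sUG FU _] := maxU; case: nFG; apply: F_eq FU; apply/eqP.
by rewrite eqEsubset sUG -defRL mul_subG // sRU.
Qed.

End Theory.

Theorem theoremD (F : group_class) (hform : formation F) (hsat : saturated F)
    (hher : hereditary F) (hnil : contains_nilpotent F)
    (gT : finGroupType) (G : {group gT}) :
  Int_star F G = Int F G.
Proof.
apply/val_inj/eqP; rewrite eqEsubset; apply/andP; split; last first.
  rewrite /= setIS //; apply/bigcapsP=> U /asboolP[maxU _].
  by apply: bigcap_inf; apply/asboolP.
rewrite [X in _ \subset X]/= subsetI subsetIl; apply/bigcapsP=> U /asboolP maxU.
apply: (@star_bounded_sub F hform hsat hher hnil gT (Int_star F G) G) maxU.
split=> [|V]; [exact: Int_star_normal | exact: Int_star_sub].
Qed.
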